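(* Let $B$ be a bimonad on a monoidal category $\mathscr{C}$, and let $T$ be a monad on a right $\mathscr{C}$-module category $\mathscr{M}$. Coactions of $B$ on $T$ (i.e. structures on $T$ of a comodule monad over $B$, extending the given monad structure) are in bijection with right actions of $\mathscr{C}^B$ on $\mathscr{M}^T$ such that the forgetful functor $U^T\colon\mathscr{M}^T\to\mathscr{M}$ is a strict comodule functor over the forgetful functor $U^B\colon\mathscr{C}^B\to\mathscr{C}$.
   Context: Associators and unitors are suppressed. A bimonad on $\mathscr{C}$ is a monad $(B,\mu,\eta)$ together with an oplax monoidal structure $B_{2;x,y}\colon B(x\otimes y)\to Bx\otimes By$, $B_0\colon B1\to1$ such that $\mu,\eta$ are oplax monoidal transformations. Its Eilenberg–Moore category $\mathscr{C}^B$ is then monoidal, with $(x,\nabla_x)\otimes(y,\nabla_y)=(x\otimes y,(\nabla_x\otimes\nabla_y)\circ B_{2;x,y})$ and unit $(1,B_0)$, so that $U^B$ is strict monoidal. $\mathscr{M}^T$ denotes the Eilenberg–Moore category of $T$. A comodule monad over $B$ on $\mathscr{M}$ is a monad $(T,\mu,\eta)$ on $\mathscr{M}$ with a natural transformation (the coaction) $T_{\mathsf a;m,x}\colon T(m\triangleleft x)\to Tm\triangleleft Bx$ such that $(T_{\mathsf a;m,x}\triangleleft By)\circ T_{\mathsf a;m\triangleleft x,y}=(Tm\triangleleft B_{2;x,y})\circ T_{\mathsf a;m,x\otimes y}$, $(Tm\triangleleft B_0)\circ T_{\mathsf a;m,1}=\mathrm{id}_{Tm}$, $T_{\mathsf a;m,x}\circ\mu_{m\triangleleft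 x}=(\mu_m\triangleleft\mu_x)\circ T_{\mathsf a;Tm,Bx}\circ T(T_{\mathsf a;m,x})$, and $T_{\mathsf a;m,x}\circ\eta_{m\triangleleft x}=\eta_m\triangleleft\eta_x$. $U^T$ being a strict comodule functor over $U^B$ means that $U^T(M\triangleleft X)=U^TM\triangleleft U^BX$ for $M\in\mathscr{M}^T$, $X\in\mathscr{C}^B$ (also on morphisms), and that the identities satisfy the coassociativity and counitality conditions of a comodule functor over $U^B$ (where a comodule functor $G$ over an oplax monoidal functor $F$ has a coaction $G(m\triangleleft x)\to Gm\triangleleft Fx$ compatible with $F_2$ and $F_0$). *)

(* Defs.v *)
From Corelib Require Import ssreflect ssrfun.
From Stdlib Require Import ProofIrrelevance.

Set Implicit Arguments.
Unset Strict Implicit.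
Unset Printing Implicit Defensive.

Declare Scope cat_scope.
Delimit Scope cat_scope with cat.
Open Scope cat_scope.

(** * Categories, functors, natural transformations *)

Record Category : Type := {
  obj :> Type;
  hom : obj -> obj -> Type;
  idm : forall x, hom x x;
  comp : forall x y z, hom y z -> hom x y -> hom x z;
  comp_idl : forall x y (f : hom x y), comp (idm y) f = f;
  comp_idr : forall x y (f : hom x y), comp f (idm x) = f;
  comp_assoc : forall w x y z (h : hom y z) (g : hom x y) (f : hom w x),
    comp h (comp g f) = comp (comp h g) f }.

Arguments hom {_} _ _.
Arguments idm {_} _.
Arguments comp {_ _ _ _} _ _.

Notation "g ∘ f" := (comp g f) (at level 40, left associativity) : cat_scope.

Definition is_iso (C : Category) (x y : C) (f : hom x y) : Prop :=
  exists g : hom y x, g ∘ f = idm x /\ f ∘ g = idm y.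

(* The identity morphism of [x], retyped along an equality of objects. *)
Definition eq_hom (C : Category) (x y : C) (e : x = y) : hom x y :=
  match e in _ = z return hom x z with eq_refl => idm x end.

Record Functor (C D : Category) : Type := {
  fobj :> C -> D;
  fmap : forall x y, hom x y -> hom (fobj x) (fobj y);
  fmap_id : forall x, fmap (idm x) = idm (fobj x);
  fmap_comp : forall x y z (g : hom y z) (f : hom x y),
    fmap (g ∘ f) = fmap g ∘ fmap f }.

Arguments fmap {_ _} _ {_ _} _.

Definition functor_id (C : Category) : Functor C C :=
  {| fobj := fun x => x;
     fmap := fun _ _ f => f;
     fmap_id := fun _ => erefl;
     fmap_comp := fun _ _ _ _ _ => erefl |}.

Section FunctorComp.
Variables (C D E : Category) (G : Functor D E) (F : Functor C D).

Lemma functor_comp_id x : fmap G (fmap F (idm x)) = idm (G (F x)).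
Proof. by rewrite !fmap_id. Qed.

Lemma functor_comp_comp x y z (g : hom y z) (f : hom x y) :
  fmap G (fmap F (g ∘ f)) = fmap G (fmap F g) ∘ fmap G (fmap F f).
Proof. by rewrite !fmap_comp. Qed.

Definition functor_comp : Functor C E :=
  {| fobj := fun x => G (F x);
     fmap := fun _ _ f => fmap G (fmap F f);
     fmap_id := functor_comp_id;
     fmap_comp := functor_comp_comp |}.
End FunctorComp.

Record NatTrans (C D : Category) (F G : Functor C D) : Type := {
  component :> forall x, hom (F x) (G x);
  naturality : forall x y (f : hom x y),
    component y ∘ fmap F f = fmap G f ∘ component x }.

(* A functor [C × D -> E], curried. *)
Record Bifunctor (C D E : Category) : Type := {
  bobj :> C -> D -> E;
  bmap : forall x x' y y', hom x x' -> hom y y' -> hom (bobj x y) (bobj x' y');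
  bmap_id : forall x y, bmap (idm x) (idm y) = idm (bobj x y);
  bmap_comp : forall x x' x'' y y' y''
      (f' : hom x' x'') (f : hom x x') (g' : hom y' y'') (g : hom y y'),
    bmap (f' ∘ f) (g' ∘ g) = bmap f' g' ∘ bmap f g }.

Arguments bmap {_ _ _} _ {_ _ _ _} _ _.

Lemma bmap_compl (C D E : Category) (H : Bifunctor C D E) x x' x'' y
    (f' : hom x' x'') (f : hom x x') :
  bmap H (f' ∘ f) (idm y) = bmap H f' (idm y) ∘ bmap H f (idm y).
Proof. by rewrite -bmap_comp comp_idl. Qed.

Lemma bmap_compr (C D E : Category) (H : Bifunctor C D E) x y y' y''
    (g' : hom y' y'') (g : hom y y') :
  bmap H (idm x) (g' ∘ g) = bmap H (idm x) g' ∘ bmap H (idm x) g.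
Proof. by rewrite -bmap_comp comp_idl. Qed.

(** * Monoidal categories, right module categories *)

Record MonoidalCategory : Type := {
  mcat :> Category;
  tensor : Bifunctor mcat mcat mcat;
  munit : mcat;
  massoc : forall x y z, hom (tensor (tensor x y) z) (tensor x (tensor y z));
  mlunit : forall x, hom (tensor munit x) x;
  mrunit : forall x, hom (tensor x munit) x;
  massoc_iso : forall x y z, is_iso (massoc x y z);
  mlunit_iso : forall x, is_iso (mlunit x);
  mrunit_iso : forall x, is_iso (mrunit x);
  massoc_nat : forall x x' y y' z z' (f : hom x x') (g : hom y y') (h : hom z z'),
    massoc x' y' z' ∘ bmap tensor (bmap tensor f g) h
    = bmap tensor f (bmap tensor g h) ∘ massoc x y z;
  mlunit_nat : forall x x' (f : hom x x'),
    mlunit x' ∘ bmap tensor (idm munit) f = f ∘ mlunit x;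
  mrunit_nat : forall x x' (f : hom x x'),
    mrunit x' ∘ bmap tensor f (idm munit) = f ∘ mrunit x;
  mpentagon : forall w x y z,
    massoc w x (tensor y z) ∘ massoc (tensor w x) y z
    = bmap tensor (idm w) (massoc x y z) ∘ massoc w (tensor x y) z
      ∘ bmap tensor (massoc w x y) (idm z);
  mtriangle : forall x y,
    bmap tensor (idm x) (mlunit y) ∘ massoc x munit y
    = bmap tensor (mrunit x) (idm y) }.

Arguments munit {_}.
Arguments massoc {_} _ _ _.
Arguments mlunit {_} _.
Arguments mrunit {_} _.

Notation "x ⊗ y" := (bobj (tensor _) x y)
  (at level 38, left associativity) : cat_scope.
Notation "f ⊠ g" := (bmap (tensor _) f g)
  (at level 38, left associativity) : cat_scope.

(* A right [C]-module category is a category [M] with such a structure. *)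
Record RightAction (C : MonoidalCategory) (M : Category) : Type := {
  act :> Bifunctor M C M;
  aassoc : forall m x y, hom (act (act m x) y) (act m (x ⊗ y));
  aunit : forall m, hom (act m munit) m;
  aassoc_iso : forall m x y, is_iso (aassoc m x y);
  aunit_iso : forall m, is_iso (aunit m);
  aassoc_nat : forall m m' x x' y y' (f : hom m m') (g : hom x x') (h : hom y y'),
    aassoc m' x' y' ∘ bmap act (bmap act f g) h
    = bmap act f (g ⊠ h) ∘ aassoc m x y;
  aunit_nat : forall m m' (f : hom m m'),
    aunit m' ∘ bmap act f (idm munit) = f ∘ aunit m;
  apentagon : forall m x y z,
    aassoc m x (y ⊗ z) ∘ aassoc (act m x) y z
    = bmap act (idm m) (massoc x y z) ∘ aassoc m (x ⊗ y) z
      ∘ bmap act (aassoc m x y) (idm z);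
  atriangle : forall m x,
    bmap act (idm m) (mlunit x) ∘ aassoc m munit x
    = bmap act (aunit m) (idm x) }.

Notation "m ◁[ A ] x" := (bobj (act A) m x)
  (at level 38, left associativity, format "m  ◁[ A ]  x") : cat_scope.
Notation "f ◀[ A ] g" := (bmap (act A) f g)
  (at level 38, left associativity, format "f  ◀[ A ]  g") : cat_scope.

(** * Oplax monoidal functors and comodule functors *)

Record Oplax (C D : MonoidalCategory) (F : Functor C D) : Type := {
  oplax2 : forall x y, hom (F (x ⊗ y)) (F x ⊗ F y);
  oplax0 : hom (F munit) munit;
  oplax2_nat : forall x x' y y' (f : hom x x') (g : hom y y'),
    oplax2 x' y' ∘ fmap F (f ⊠ g) = (fmap F f ⊠ fmap F g) ∘ oplax2 x y;
  oplax_coassoc : forall x y z,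
    massoc (F x) (F y) (F z) ∘ (oplax2 x y ⊠ idm (F z)) ∘ oplax2 (x ⊗ y) z
    = (idm (F x) ⊠ oplax2 y z) ∘ oplax2 x (y ⊗ z) ∘ fmap F (massoc x y z);
  oplax_counitl : forall x,
    mlunit (F x) ∘ (oplax0 ⊠ idm (F x)) ∘ oplax2 munit x = fmap F (mlunit x);
  oplax_counitr : forall x,
    mrunit (F x) ∘ (idm (F x) ⊠ oplax0) ∘ oplax2 x munit = fmap F (mrunit x) }.

Lemma oplax2_natl (C D : MonoidalCategory) (F : Functor C D) (oF : Oplax F)
    x x' y (f : hom x x') :
  (fmap F f ⊠ idm (F y)) ∘ oplax2 oF x y = oplax2 oF x' y ∘ fmap F (f ⊠ idm y).
Proof. by rewrite oplax2_nat fmap_id. Qed.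

Lemma oplax2_natr (C D : MonoidalCategory) (F : Functor C D) (oF : Oplax F)
    x y y' (g : hom y y') :
  (idm (F x) ⊠ fmap F g) ∘ oplax2 oF x y = oplax2 oF x y' ∘ fmap F (idm x ⊠ g).
Proof. by rewrite oplax2_nat fmap_id. Qed.

Record OplaxTransformation (C D : MonoidalCategory) (F G : Functor C D)
    (oF : Oplax F) (oG : Oplax G) (t : NatTrans F G) : Prop := {
  oplax_trans2 : forall x y,
    oplax2 oG x y ∘ t (x ⊗ y) = (t x ⊠ t y) ∘ oplax2 oF x y;
  oplax_trans0 : oplax0 oG ∘ t munit = oplax0 oF }.

Section OplaxId.
Variable C : MonoidalCategory.

Definition oplax_id : Oplax (functor_id C).
Proof.
refine {| oplax2 := fun x y => idm (x ⊗ y) : hom (functor_id C (x ⊗ y)) _;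
          oplax0 := idm munit |} => /= *;
  by rewrite ?bmap_id ?comp_idl ?comp_idr.
Defined.
End OplaxId.

Section OplaxComp.
Variables (C D E : MonoidalCategory) (G : Functor D E) (F : Functor C D).
Variables (oG : Oplax G) (oF : Oplax F).

Definition oplax_comp : Oplax (functor_comp G F).
Proof.
refine {| oplax2 := fun x y => oplax2 oG (F x) (F y) ∘ fmap G (oplax2 oF x y)
                      : hom (functor_comp G F (x ⊗ y)) _;
          oplax0 := oplax0 oG ∘ fmap G (oplax0 oF) |} => /=.
- move=> x x' y y' f g.
  by rewrite -comp_assoc -fmap_comp oplax2_nat fmap_comp !comp_assoc oplax2_nat.
- move=> x y z.
  rewrite bmap_compl bmap_compr -!comp_assoc.
  rewrite (comp_assoc (fmap G _ ⊠ _)) oplax2_natl.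
  rewrite (comp_assoc (_ ⊠ fmap G _)) oplax2_natr.
  by rewrite -!comp_assoc -!fmap_comp 2!comp_assoc oplax_coassoc
             -!comp_assoc -fmap_comp !comp_assoc oplax_coassoc.
- move=> x; rewrite bmap_compl -!comp_assoc.
  rewrite (comp_assoc (fmap G _ ⊠ _)) oplax2_natl.
  by rewrite -!comp_assoc -!fmap_comp 2!comp_assoc oplax_counitl
             -fmap_comp comp_assoc oplax_counitl.
- move=> x; rewrite bmap_compr -!comp_assoc.
  rewrite (comp_assoc (_ ⊠ fmap G _)) oplax2_natr.
  by rewrite -!comp_assoc -!fmap_comp 2!comp_assoc oplax_counitr
             -fmap_comp comp_assoc oplax_counitr.
Defined.
End OplaxComp.

Record ComoduleFunctor (C D : MonoidalCategory) (M N : Category)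
    (A : RightAction C M) (A' : RightAction D N)
    (F : Functor C D) (oF : Oplax F) (G : Functor M N) : Type := {
  coact :> forall m x, hom (G (m ◁[A] x)) (G m ◁[A'] F x);
  coact_nat : forall m m' x x' (f : hom m m') (g : hom x x'),
    coact m' x' ∘ fmap G (f ◀[A] g) = (fmap G f ◀[A'] fmap F g) ∘ coact m x;
  coact_coassoc : forall m x y,
    aassoc A' (G m) (F x) (F y) ∘ (coact m x ◀[A'] idm (F y))
      ∘ coact (m ◁[A] x) y
    = (idm (G m) ◀[A'] oplax2 oF x y) ∘ coact m (x ⊗ y)
      ∘ fmap G (aassoc A m x y);
  coact_counit : forall m,
    aunit A' (G m) ∘ (idm (G m) ◀[A'] oplax0 oF) ∘ coact m munit
    = fmap G (aunit A m) }.

(* [G (m ◁ x) = G m ◁ F x] on objects, and the resulting family of identities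
   is a comodule functor structure; its naturality is the corresponding
   equality on morphisms. *)
Definition StrictComoduleFunctor (C D : MonoidalCategory) (M N : Category)
    (A : RightAction C M) (A' : RightAction D N)
    (F : Functor C D) (oF : Oplax F) (G : Functor M N) : Prop :=
  exists s : ComoduleFunctor A A' oF G,
    forall m x, exists e : G (m ◁[A] x) = G m ◁[A'] F x, s m x = eq_hom e.

(** * Monads, bimonads, comodule monads *)

Record Monad (C : Category) : Type := {
  mfun :> Functor C C;
  mu : NatTrans (functor_comp mfun mfun) mfun;
  eta : NatTrans (functor_id C) mfun;
  mu_assoc : forall x, mu x ∘ fmap mfun (mu x) = mu x ∘ mu (mfun x);
  mu_etal : forall x, mu x ∘ eta (mfun x) = idm (mfun x);
  mu_etar : forall x, mu x ∘ fmap mfun (eta x) = idm (mfun x) }.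

Record Bimonad (C : MonoidalCategory) : Type := {
  bmonad :> Monad C;
  boplax : Oplax bmonad;
  mu_oplax : OplaxTransformation (oplax_comp boplax boplax) boplax (mu bmonad);
  eta_oplax : OplaxTransformation (oplax_id C) boplax (eta bmonad) }.

Record Coaction (C : MonoidalCategory) (B : Bimonad C)
    (M : Category) (A : RightAction C M) (T : Monad M) : Type := {
  cact :> ComoduleFunctor A A (boplax B) T;
  cact_mu : forall m x,
    cact m x ∘ mu T (m ◁[A] x)
    = (mu T m ◀[A] mu B x) ∘ cact (T m) (B x) ∘ fmap T (cact m x);
  cact_eta : forall m x,
    cact m x ∘ eta T (m ◁[A] x) = eta T m ◀[A] eta B x }.

(** * Eilenberg-Moore categories *)

Section EilenbergMoore.
Variables (C : Category) (T : Monad C).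

Record Algebra : Type := {
  carrier :> C;
  nabla : hom (T carrier) carrier;
  nabla_mu : nabla ∘ fmap T nabla = nabla ∘ mu T carrier;
  nabla_eta : nabla ∘ eta T carrier = idm carrier }.

Record AlgHom (X Y : Algebra) : Type := {
  alg_map : hom (carrier X) (carrier Y);
  alg_mapP : alg_map ∘ nabla X = nabla Y ∘ fmap T alg_map }.

Lemma AlgHom_eq X Y (f g : AlgHom X Y) : alg_map f = alg_map g -> f = g.
Proof.
case: f g => [f fP] [g gP] /= fg; subst g.
by rewrite (proof_irrelevance _ fP gP).
Qed.

Lemma alg_idP (X : Algebra) :
  idm (carrier X) ∘ nabla X = nabla X ∘ fmap T (idm (carrier X)).
Proof. by rewrite fmap_id comp_idl comp_idr. Qed.

Lemma alg_compP (X Y Z : Algebra) (g : AlgHom Y Z) (f : AlgHom X Y) :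
  alg_map g ∘ alg_map f ∘ nabla X = nabla Z ∘ fmap T (alg_map g ∘ alg_map f).
Proof.
by rewrite -comp_assoc alg_mapP comp_assoc alg_mapP fmap_comp !comp_assoc.
Qed.

Definition EM : Category.
Proof.
refine {| obj := Algebra;
          hom := AlgHom;
          idm := fun X => {| alg_map := idm (carrier X); alg_mapP := alg_idP X |};
          comp := fun _ _ _ g f => {| alg_map := alg_map g ∘ alg_map f;
                                      alg_mapP := alg_compP g f |} |}
  => *; apply: AlgHom_eq => /=.
- exact: comp_idl.
- exact: comp_idr.
- exact: comp_assoc.
Defined.

Definition EM_forget : Functor EM C :=
  {| fobj := fun X : EM => carrier X;
     fmap := fun (X Y : EM) (f : hom X Y) => alg_map f;
     fmap_id := fun _ => erefl;
     fmap_comp := fun _ _ _ _ _ => erefl |}.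

Lemma EM_iso (X Y : EM) (f : hom X Y) : is_iso (alg_map f) -> is_iso f.
Proof.
case=> g [gf fg].
have gP : g ∘ nabla Y = nabla X ∘ fmap T g.
  rewrite -[LHS]comp_idr -(fmap_id T) -fg fmap_comp -comp_assoc.
  rewrite (comp_assoc (nabla Y)) -alg_mapP.
  by rewrite -!comp_assoc comp_assoc gf comp_idl.
by exists (Build_AlgHom gP); split; apply: AlgHom_eq.
Qed.
End EilenbergMoore.

Section EMMonoidal.
Variables (C : MonoidalCategory) (B : Bimonad C).

Definition EM_tensor_obj (X Y : EM B) : EM B.
Proof.
refine {| carrier := carrier X ⊗ carrier Y;
          nabla := (nabla X ⊠ nabla Y) ∘ oplax2 (boplax B) _ _ |}.
- have := oplax_trans2 (mu_oplax B) (carrier X) (carrier Y) => /= E.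
  rewrite -(comp_assoc _ _ (mu _ _)) E fmap_comp !comp_assoc.
  rewrite -[in LHS](comp_assoc _ (oplax2 _ _ _)) oplax2_nat.
  by rewrite !comp_assoc -!bmap_comp !nabla_mu.
- have := oplax_trans2 (eta_oplax B) (carrier X) (carrier Y) => /= E.
  by rewrite -comp_assoc E comp_idr -bmap_comp !nabla_eta bmap_id.
Defined.

Definition EM_tensor_map (X X' Y Y' : EM B) (f : hom X X') (g : hom Y Y') :
  hom (EM_tensor_obj X Y) (EM_tensor_obj X' Y').
Proof.
refine {| alg_map := alg_map f ⊠ alg_map g
            : hom (EM_tensor_obj X Y : C) (EM_tensor_obj X' Y' : C) |} => /=.
by rewrite comp_assoc -bmap_comp !alg_mapP bmap_comp -!comp_assoc oplax2_nat.
Defined.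

Definition EM_tensor : Bifunctor (EM B) (EM B) (EM B).
Proof.
refine {| bobj := EM_tensor_obj; bmap := EM_tensor_map |}
  => *; apply: AlgHom_eq => /=.
- exact: bmap_id.
- exact: bmap_comp.
Defined.

Definition EM_unit : EM B.
Proof.
refine {| carrier := munit; nabla := oplax0 (boplax B) |}.
- exact: esym (oplax_trans0 (mu_oplax B)).
- exact: oplax_trans0 (eta_oplax B).
Defined.

Definition EM_assoc (X Y Z : EM B) :
  hom (EM_tensor (EM_tensor X Y) Z) (EM_tensor X (EM_tensor Y Z)).
Proof.
refine {| alg_map := massoc (carrier X) (carrier Y) (carrier Z)
            : hom (EM_tensor (EM_tensor X Y) Z : C)
                  (EM_tensor X (EM_tensor Y Z) : C) |} => /=.
rewrite -[nabla Z]comp_idr bmap_comp !comp_assoc massoc_nat.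
rewrite -!comp_assoc (comp_assoc (massoc _ _ _)) oplax_coassoc.
by rewrite -[nabla X in RHS]comp_idr bmap_comp comp_idr !comp_assoc.
Defined.

Definition EM_lunit (X : EM B) : hom (EM_tensor EM_unit X) X.
Proof.
refine {| alg_map := mlunit (carrier X)
            : hom (EM_tensor EM_unit X : C) (X : C) |} => /=.
rewrite -[oplax0 _]comp_idl -[nabla X in LHS]comp_idr bmap_comp !comp_assoc.
by rewrite mlunit_nat -(oplax_counitl (boplax B)) !comp_assoc.
Defined.

Definition EM_runit (X : EM B) : hom (EM_tensor X EM_unit) X.
Proof.
refine {| alg_map := mrunit (carrier X)
            : hom (EM_tensor X EM_unit : C) (X : C) |} => /=.
rewrite -[oplax0 _]comp_idl -[nabla X in LHS]comp_idr bmap_comp !comp_assoc.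
by rewrite mrunit_nat -(oplax_counitr (boplax B)) !comp_assoc.
Defined.

Definition EM_monoidal : MonoidalCategory.
Proof.
refine {| mcat := EM B; tensor := EM_tensor; munit := EM_unit;
          massoc := EM_assoc; mlunit := EM_lunit; mrunit := EM_runit |}
  => *; try apply: EM_iso; try apply: AlgHom_eq => /=.
- exact: massoc_iso.
- exact: mlunit_iso.
- exact: mrunit_iso.
- exact: massoc_nat.
- exact: mlunit_nat.
- exact: mrunit_nat.
- exact: mpentagon.
- exact: mtriangle.
Defined.

(* [U^B] as a functor between monoidal categories, with its strict structure. *)
Definition EM_forget_monoidal : Functor EM_monoidal C := EM_forget B.

Definition EM_forget_oplax : Oplax EM_forget_monoidal.
Proof.
refine {| oplax2 := fun X Y : EM_monoidal => idm (carrier X ⊗ carrier Y)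
            : hom (EM_forget_monoidal (X ⊗ Y)) _;
          oplax0 := idm munit : hom (EM_forget_monoidal munit) munit |} => /= *;
  by rewrite ?bmap_id ?comp_idl ?comp_idr.
Defined.
End EMMonoidal.

(* Main.v *)
Require Import Defs.
From Corelib Require Import ssreflect ssrfun.
From Stdlib Require Import ProofIrrelevance FunctionalExtensionality.

(** Write [F] for the free algebra functors and [U] for the forgetful ones. An
    action of [EM B] on [EM T] for which [U] is strict has no freedom left except
    the algebra structures [n m x : T (U m ◁ U x) -> U m ◁ U x] that it puts on
    the underlying objects: its morphism part, associator and unitor are mapped
    by the faithful [U] to those of [A]. What remains to be asked of [n] is that
    each [n m x] is an algebra structure and that the morphisms [f ◀ g], the
    associators and the unitors of [A] are algebra morphisms. This is an
    [ActionLift], and the theorem is the composite of two bijections.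

    Lifts and coactions. A coaction [Ta] gives [n m x = (∇ ◀ ∇) ∘ Ta (U m) (U x)],
    just as [EM B] is made monoidal. A lift [n] gives the coaction that is adjunct
    to [η ◀ η], namely
    [T (m ◁ x) -> T (T m ◁ B x) -> T m ◁ B x], first [T (η ◀ η)] and then
    [n (F m) (F x)]. Its axioms hold because [n] is natural in algebra morphisms
    and because [B_2 : F (x ⊗ y) -> F x ⊗ F y], [B_0 : F 1 -> 1] and the
    multiplications [μ : F (T m) -> F m], [μ : F (B x) -> F x] are algebra
    morphisms. The two constructions are inverse to each other by the unit laws
    [∇ ∘ η = id] and [μ ∘ T η = id] ([lift_of_coactionK], [coaction_of_liftK]).

    Lifts and strict actions. A lift defines an action on objects
    [(U m ◁ U x, n m x)], strictly over [A]. Conversely a strict action only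
    satisfies [U (m ◁' x) = U m ◁ U x] as an equality between objects, so its
    algebra structures are first transported along these equalities. The
    transported structure determines the action up to equality
    ([strict_action_eq]): it determines the objects, hence by the coherence of
    the identity coaction also the morphism part, the associator and the
    unitor. *)

Set Implicit Arguments.
Unset Strict Implicit.
Unset Printing Implicit Defensive.

Local Open Scope cat_scope.

(** * Free algebras, and transport of algebra structures *)

Section EilenbergMooreComplements.
Variables (C : Category) (T : Monad C).

Lemma eta_nat x y (f : hom x y) : fmap T f ∘ eta T x = eta T y ∘ f.
Proof. by rewrite -(naturality (eta T)). Qed.

Lemma mu_nat x y (f : hom x y) :
  mu T y ∘ fmap T (fmap T f) = fmap T f ∘ mu T x.
Proof. exact: (naturality (mu T)). Qed.

Definition free_alg (x : C) : EM T :=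
  {| carrier := T x; nabla := mu T x;
     nabla_mu := mu_assoc T x; nabla_eta := mu_etal T x |}.

(** The counit at [X] of the free-forgetful adjunction. *)
Definition alg_counit (X : EM T) : hom (free_alg (carrier X)) X :=
  {| alg_map := nabla X : hom (carrier (free_alg (carrier X))) (carrier X);
     alg_mapP := esym (nabla_mu X) |}.

Lemma free_ext_algP (x : C) (X : EM T) (f : hom x (carrier X)) :
  nabla X ∘ fmap T f ∘ mu T x = nabla X ∘ fmap T (nabla X ∘ fmap T f).
Proof.
by rewrite fmap_comp comp_assoc nabla_mu -!comp_assoc mu_nat.
Qed.

(** The algebra morphism adjunct to [f]. *)
Definition free_ext (x : C) (X : EM T) (f : hom x (carrier X)) :
    hom (free_alg x) X :=
  {| alg_map := nabla X ∘ fmap T f : hom (carrier (free_alg x)) (carrier X);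
     alg_mapP := free_ext_algP f |}.

Lemma free_ext_eta (x : C) (X : EM T) (f : hom x (carrier X)) :
  alg_map (free_ext f) ∘ eta T x = f.
Proof. by rewrite /= -comp_assoc eta_nat comp_assoc nabla_eta comp_idl. Qed.

Lemma Algebra_eq (z : C) (a b : hom (T z) z) am ae bm be : a = b ->
  @Build_Algebra C T z a am ae = @Build_Algebra C T z b bm be.
Proof.
move=> E; subst b.
by rewrite (proof_irrelevance _ am bm) (proof_irrelevance _ ae be).
Qed.

Definition free_map (x y : C) (f : hom x y) : hom (free_alg x) (free_alg y) :=
  {| alg_map := fmap T f : hom (carrier (free_alg x)) (carrier (free_alg y));
     alg_mapP := esym (mu_nat f) |}.

Section Transport.
Variables (X : Algebra T) (z : C) (e : carrier X = z).

(** Defined by matching on the equality, rather than by conjugating with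
    [eq_hom e], so that the algebra laws are those of [X] once [e] is [erefl]. *)
Definition transport_nabla : hom (T z) z :=
  match e in _ = y return hom (T y) y with erefl => nabla X end.

Lemma transport_nablaP :
  eq_hom e ∘ nabla X = transport_nabla ∘ fmap T (eq_hom e).
Proof.
rewrite /transport_nabla; case: z / e => /=.
by rewrite fmap_id comp_idl comp_idr.
Qed.

Lemma transport_nabla_mu :
  transport_nabla ∘ fmap T transport_nabla = transport_nabla ∘ mu T z.
Proof. by rewrite /transport_nabla; case: z / e; apply: nabla_mu. Qed.

Lemma transport_nabla_eta : transport_nabla ∘ eta T z = idm z.
Proof. by rewrite /transport_nabla; case: z / e; apply: nabla_eta. Qed.

Definition transport_alg : EM T :=
  {| carrier := z; nabla := transport_nabla;
     nabla_mu := transport_nabla_mu; nabla_eta := transport_nabla_eta |}.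

Definition transport_hom : hom (X : EM T) transport_alg :=
  {| alg_map := eq_hom e : hom (carrier X) (carrier transport_alg);
     alg_mapP := transport_nablaP |}.

Lemma transport_invP :
  eq_hom (esym e) ∘ transport_nabla = nabla X ∘ fmap T (eq_hom (esym e)).
Proof.
rewrite /transport_nabla; case: z / e => /=.
by rewrite fmap_id comp_idl comp_idr.
Qed.

Definition transport_inv : hom transport_alg X :=
  {| alg_map := eq_hom (esym e) : hom (carrier transport_alg) (carrier X);
     alg_mapP := transport_invP |}.

(** The criterion by which morphisms become algebra morphisms for a transported
    structure: it suffices that [f] is, after retyping, the map of a given
    algebra morphism out of [X]. *)
Lemma transport_algP (Y : EM T) (u : hom (X : EM T) Y) (f : hom z (carrier Y)) :
  alg_map u = f ∘ eq_hom e ->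
  f ∘ transport_nabla = nabla Y ∘ fmap T f.
Proof.
rewrite /transport_nabla; case: z / e f => f /=; rewrite comp_idr => <-.
exact: alg_mapP.
Qed.

(** Transport does not leave the equality class of [X]; so algebras with
    equal carriers and equal transported structures are equal. *)
Lemma transport_algE : transport_alg = X.
Proof.
rewrite /transport_alg; move: transport_nabla_mu transport_nabla_eta.
rewrite /transport_nabla; case: z / e => p q.
by case: X p q => c n nm ne p q /=; apply: Algebra_eq.
Qed.
End Transport.

End EilenbergMooreComplements.

Lemma eq_hom_mono (C : Category) (x y z : C) (e : y = z) (f g : hom x y) :
  eq_hom e ∘ f = eq_hom e ∘ g -> f = g.
Proof. by case: z / e => /=; rewrite !comp_idl. Qed.

Lemma eq_hom_esymr (C : Category) (x y : C) (e : x = y) :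
  eq_hom e ∘ eq_hom (esym e) = idm y.
Proof. by case: y / e => /=; rewrite comp_idl. Qed.

(** * Lifts of an action to algebras *)

Section ActionLifts.
Variables (C : MonoidalCategory) (B : Bimonad C).
Variables (M : Category) (A : RightAction C M) (T : Monad M).

(** The part of a strict action that is not prescribed by strictness. In
    [lnabla_assoc], the inner action [m ◁ x] must carry its new algebra structure,
    because [lnabla] takes algebras and not mere objects as arguments. *)
Record ActionLift : Type := {
  lnabla : forall (m : EM T) (x : EM_monoidal B),
    hom (T (carrier m ◁[A] carrier x)) (carrier m ◁[A] carrier x);
  lnabla_mu : forall m x,
    lnabla m x ∘ fmap T (lnabla m x) = lnabla m x ∘ mu T _;
  lnabla_eta : forall m x, lnabla m x ∘ eta T _ = idm _;
  lnabla_nat : forall (m m' : EM T) (x x' : EM_monoidal B)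
      (f : hom m m') (g : hom x x'),
    (alg_map f ◀[A] alg_map g) ∘ lnabla m x
    = lnabla m' x' ∘ fmap T (alg_map f ◀[A] alg_map g);
  lnabla_assoc : forall m x y,
    aassoc A _ _ _ ∘ lnabla (Build_Algebra (lnabla_mu m x) (lnabla_eta m x)) y
    = lnabla m (x ⊗ y) ∘ fmap T (aassoc A (carrier m) (carrier x) (carrier y));
  lnabla_unit : forall m,
    aunit A (carrier m) ∘ lnabla m munit
    = nabla m ∘ fmap T (aunit A (carrier m)) }.

Lemma ActionLift_eq (L L' : ActionLift) :
  (forall m x, lnabla L m x = lnabla L' m x) -> L = L'.
Proof.
case: L L' => [n nm ne nn na nu] [n' nm' ne' nn' na' nu'] /= E.
have {}E : n = n'.
  by apply: functional_extensionality_dep => m;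
     apply: functional_extensionality_dep.
subst n'.
have E : nm = nm' by apply: proof_irrelevance.
subst nm'.
have E : ne = ne' by apply: proof_irrelevance.
subst ne'.
by f_equal; apply: proof_irrelevance.
Qed.

(** * Lifts and coactions *)

Section LiftOfCoaction.
Variable Ta : Coaction B A T.

Let n (m : EM T) (x : EM_monoidal B) :=
  (nabla m ◀[A] nabla x) ∘ Ta (carrier m) (carrier x).

Lemma coaction_nabla_mu m x : n m x ∘ fmap T (n m x) = n m x ∘ mu T _.
Proof.
rewrite /n -[in RHS]comp_assoc cact_mu fmap_comp !comp_assoc.
rewrite -(comp_assoc _ (Ta _ _)) coact_nat !comp_assoc.
by rewrite -!bmap_comp !nabla_mu.
Qed.

Lemma coaction_nabla_eta m x : n m x ∘ eta T _ = idm _.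
Proof. by rewrite /n -comp_assoc cact_eta -bmap_comp !nabla_eta bmap_id. Qed.

(** Naturality, coassociativity and counitality of the coaction are what makes
    [f ◀ g], the associators and the unitors, respectively, algebra morphisms. *)
Definition lift_of_coaction : ActionLift.
Proof.
refine {| lnabla := n; lnabla_mu := coaction_nabla_mu;
          lnabla_eta := coaction_nabla_eta |}; rewrite /n.
- move=> m m' x x' f g.
  by rewrite comp_assoc -bmap_comp !alg_mapP bmap_comp -!comp_assoc coact_nat.
- move=> m x y /=.
  rewrite -[nabla y]comp_idr bmap_comp !comp_assoc aassoc_nat.
  rewrite -!comp_assoc (comp_assoc (aassoc _ _ _ _)) coact_coassoc.
  by rewrite -[nabla m in RHS]comp_idr bmap_comp comp_idr !comp_assoc.
- move=> m /=.
  rewrite -[oplax0 _]comp_idl -[nabla m in LHS]comp_idr bmap_comp !comp_assoc.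
  by rewrite aunit_nat -(coact_counit Ta) !comp_assoc.
Defined.
End LiftOfCoaction.

Section CoactionOfLift.
Variable L : ActionLift.

Definition lift_obj (m : EM T) (x : EM_monoidal B) : EM T :=
  Build_Algebra (lnabla_mu L m x) (lnabla_eta L m x).

Let F (x : C) : EM_monoidal B := free_alg B x.

Lemma oplax2_algP x y :
  oplax2 (boplax B) x y ∘ mu B _
  = nabla (F x ⊗ F y) ∘ fmap B (oplax2 (boplax B) x y).
Proof. by have /= -> := oplax_trans2 (mu_oplax B) x y; rewrite comp_assoc. Qed.

(** [B_2] and [B_0] are algebra morphisms because the multiplication of [B] is
    an oplax transformation. *)
Definition free_oplax2 x y : hom (F (x ⊗ y)) (F x ⊗ F y) :=
  {| alg_map := oplax2 (boplax B) x y
       : hom (carrier (F (x ⊗ y))) (carrier (F x ⊗ F y));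
     alg_mapP := oplax2_algP x y |}.

Definition free_oplax0 : hom (F munit) munit :=
  {| alg_map := oplax0 (boplax B)
       : hom (carrier (F munit)) (carrier (munit : EM_monoidal B));
     alg_mapP := oplax_trans0 (mu_oplax B) |}.

(** The adjunct of [η ◀ η : m ◁ x -> F m ◁' F x], as [free_ext]. *)
Definition lift_coact m x : hom (T (m ◁[A] x)) (T m ◁[A] B x) :=
  lnabla L (free_alg T m) (F x) ∘ fmap T (eta T m ◀[A] eta B x).

(** The workhorse of the coaction axioms: composing an adjunct morphism with
    the algebra morphism [f ◀ g] amounts to composing what it is adjunct to. Each
    axiom thereby reduces to an equation about units. *)
Lemma lift_extend (m m' : EM T) x (x' : EM_monoidal B)
    (f : hom m m') (g : hom (F x) x') y (h : hom y (carrier m ◁[A] B x)) :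
  (alg_map f ◀[A] alg_map g) ∘ (lnabla L m (F x) ∘ fmap T h)
  = lnabla L m' x' ∘ fmap T ((alg_map f ◀[A] alg_map g) ∘ h).
Proof. by rewrite comp_assoc lnabla_nat -comp_assoc -fmap_comp. Qed.

(** Both sides of each axiom are adjunct to morphisms out of [m ◁ x],
    [(m ◁ x) ◁ y] or [m ◁ 1], and these agree by, respectively: naturality of [η], the compatibility of [η] with
    [B_2] (with the associator being an algebra morphism), and its compatibility
    with [B_0] (with the unitor being one). *)
Definition coaction_functor : ComoduleFunctor A A (boplax B) T.
Proof.
refine {| coact := lift_coact |}; rewrite /lift_coact.
- move=> m m' x x' f g.
  rewrite (lift_extend (free_map T f) (free_map B g : hom (F x) (F x'))) /=.
  by rewrite -comp_assoc -fmap_comp -!bmap_comp !eta_nat.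
- move=> m x y.
  set k : hom (m ◁[A] x) (carrier (lift_obj (free_alg T m) (F x))) :=
    eta T m ◀[A] eta B x.
  (* The inner coaction is an algebra morphism, so [lift_extend] applies to it. *)
  have -> : (lnabla L (free_alg T m) (F x) ∘ fmap T k) ◀[A] idm (B y)
      = alg_map (free_ext k) ◀[A] alg_map (idm (F y)) by [].
  rewrite -(comp_assoc (aassoc _ _ _ _)).
  rewrite (lift_extend (free_ext k) (idm (F y))) /=.
  rewrite -bmap_comp (free_ext_eta k) comp_idl comp_assoc.
  rewrite (lnabla_assoc L (free_alg T m) (F x) (F y)) /= -comp_assoc -fmap_comp.
  rewrite /k aassoc_nat.
  have /= E := oplax_trans2 (eta_oplax B) x y; rewrite comp_idr in E.
  rewrite (lift_extend (idm (free_alg T m)) (free_oplax2 x y)) /=.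
  by rewrite -bmap_comp E comp_idl fmap_comp comp_assoc.
- move=> m.
  rewrite -(comp_assoc (aunit _ _)).
  rewrite (lift_extend (idm (free_alg T m)) free_oplax0) /=.
  have /= E := oplax_trans0 (eta_oplax B).
  rewrite -bmap_comp E comp_idl comp_assoc.
  rewrite (lnabla_unit L (free_alg T m)) /= -comp_assoc -fmap_comp aunit_nat.
  by rewrite fmap_comp comp_assoc mu_etar comp_idl.
Defined.

(** For the multiplication axiom: [μ] is the counit at a free algebra, hence an
    algebra morphism, which cancels against the units of [T] and [B]; the rest is
    the associativity of the lifted algebra structure. *)
Definition coaction_of_lift : Coaction B A T.
Proof.
refine {| cact := coaction_functor |} => m x /=; rewrite /lift_coact.
- rewrite (lift_extend (alg_counit (free_alg T m))
                       (alg_counit (F x) : hom (F (B x)) (F x))) /=.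
  rewrite -bmap_comp !mu_etal bmap_id fmap_id comp_idr fmap_comp.
  by rewrite comp_assoc (lnabla_mu L (free_alg T m) (F x)) /= -!comp_assoc mu_nat.
- by rewrite -comp_assoc eta_nat comp_assoc lnabla_eta comp_idl.
Defined.
End CoactionOfLift.

Lemma Coaction_eq (Ta Ta' : Coaction B A T) :
  (forall m x, Ta m x = Ta' m x) -> Ta = Ta'.
Proof.
case: Ta Ta' => [[c cn ca cu] cm ce] [[c' cn' ca' cu'] cm' ce'] /= E.
have {}E : c = c'.
  by apply: functional_extensionality_dep => m;
     apply: functional_extensionality_dep.
subst c'.
have E : cn = cn' by apply: proof_irrelevance.
subst cn'.
have E : ca = ca' by apply: proof_irrelevance.
subst ca'.
have E : cu = cu' by apply: proof_irrelevance.
subst cu'.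
by f_equal; apply: proof_irrelevance.
Qed.

Lemma lift_of_coactionK : cancel lift_of_coaction coaction_of_lift.
Proof.
move=> Ta; apply: Coaction_eq => m x /=; rewrite /lift_coact /=.
by rewrite -comp_assoc coact_nat comp_assoc -bmap_comp !mu_etar bmap_id comp_idl.
Qed.

Lemma coaction_of_liftK : cancel coaction_of_lift lift_of_coaction.
Proof.
move=> L; apply: ActionLift_eq => m x /=; rewrite /lift_coact.
rewrite (lift_extend L (alg_counit m) (alg_counit (x : EM B))) /=.
by rewrite -bmap_comp !nabla_eta bmap_id fmap_id comp_idr.
Qed.

(** * Lifts and strict actions *)

Notation StrictOver A' :=
  (StrictComoduleFunctor A' A (EM_forget_oplax B) (EM_forget T)).

Section ActionOfLift.
Variable L : ActionLift.

Definition lift_bifunctor : Bifunctor (EM T) (EM_monoidal B) (EM T).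
Proof.
refine {| bobj := lift_obj L;
          bmap := fun m m' x x' (f : hom m m') (g : hom x x') =>
            {| alg_map := alg_map f ◀[A] alg_map g
                 : hom (carrier (lift_obj L m x)) (carrier (lift_obj L m' x'));
               alg_mapP := lnabla_nat L f g |} |}
  => *; apply: AlgHom_eq => /=.
- exact: bmap_id.
- exact: bmap_comp.
Defined.

Definition action_of_lift : RightAction (EM_monoidal B) (EM T).
Proof.
refine {| act := lift_bifunctor;
          aassoc := fun m x y =>
            {| alg_map := aassoc A (carrier m) (carrier x) (carrier y)
                 : hom (carrier (lift_obj L (lift_obj L m x) y))
                       (carrier (lift_obj L m (x ⊗ y)));
               alg_mapP := lnabla_assoc L m x y |};
          aunit := fun m =>
            {| alg_map := aunit A (carrier m)
                 : hom (carrier (lift_obj L m munit)) (carrier m);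
               alg_mapP := lnabla_unit L m |} |}
  => *; try apply: EM_iso; try apply: AlgHom_eq => /=.
- exact: aassoc_iso.
- exact: aunit_iso.
- exact: aassoc_nat.
- exact: aunit_nat.
- exact: apentagon.
- exact: atriangle.
Defined.

Lemma action_of_lift_strict : StrictOver action_of_lift.
Proof.
unshelve eexists.
- refine (@Build_ComoduleFunctor _ _ _ _ action_of_lift A _
            (EM_forget_oplax B) (EM_forget T)
            (fun m x => idm (carrier m ◁[A] carrier x)) _ _ _) => /= *;
    by rewrite ?bmap_id ?comp_idl ?comp_idr.
- by move=> m x; exists erefl.
Qed.
End ActionOfLift.

Section LiftOfAction.
Variables (A' : RightAction (EM_monoidal B) (EM T)) (sA' : StrictOver A').

(** Strictness is a mere existence statement, but equality of objects is
    proof-irrelevant, so this weaker fact already carries the data needed to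
    define the lift. *)
Lemma strict_carrier (m : EM T) (x : EM_monoidal B) :
  carrier (m ◁[A'] x) = carrier m ◁[A] carrier x.
Proof. by case: sA' => s /(_ m x) []. Qed.

Let c m x := eq_hom (strict_carrier m x).

Lemma strict_coact :
  exists s : ComoduleFunctor A' A (EM_forget_oplax B) (EM_forget T),
    forall m x, s m x = c m x.
Proof.
case: sA' => s sE; exists s => m x; have [e ->] := sE m x.
by rewrite /c (proof_irrelevance _ (strict_carrier m x) e).
Qed.

(** Since the coaction consists of identities up to retyping, its axioms say
    that the action, its associator and its unitor are retyped versions of those
    of [A]. *)
Lemma strict_nat (m m' : EM T) (x x' : EM_monoidal B)
    (f : hom m m') (g : hom x x') :
  c m' x' ∘ alg_map (f ◀[A'] g) = (alg_map f ◀[A] alg_map g) ∘ c m x.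
Proof. by have [s sE] := strict_coact; rewrite -!sE; apply: (coact_nat s). Qed.

Lemma strict_assoc m x y :
  aassoc A _ _ _ ∘ (c m x ◀[A] idm (carrier y)) ∘ c (m ◁[A'] x) y
  = c m (x ⊗ y) ∘ alg_map (aassoc A' m x y).
Proof.
have [s sE] := strict_coact; rewrite -!sE.
by have /= := coact_coassoc s m x y; rewrite bmap_id comp_idl.
Qed.

Lemma strict_unit m : aunit A _ ∘ c m munit = alg_map (aunit A' m).
Proof.
have [s sE] := strict_coact; rewrite -!sE.
by have /= := coact_counit s m; rewrite bmap_id comp_idr.
Qed.

Let X m x : EM T := transport_alg (strict_carrier m x).

Lemma strict_nabla_nat (m m' : EM T) (x x' : EM_monoidal B)
    (f : hom m m') (g : hom x x') :
  (alg_map f ◀[A] alg_map g) ∘ nabla (X m x)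
  = nabla (X m' x') ∘ fmap T (alg_map f ◀[A] alg_map g).
Proof.
apply: (@transport_algP _ _ _ _ _ (X m' x')
          (transport_hom (strict_carrier m' x') ∘ (f ◀[A'] g))).
exact: strict_nat.
Qed.

(** The domain is a transported structure at the transported algebra [X m x],
    not at [m ◁' x]; the algebra morphism that witnesses the claim therefore
    begins with [h], which moves back from the first to the second. *)
Lemma strict_nabla_assoc m x y :
  aassoc A _ _ _ ∘ nabla (X (X m x) y)
  = nabla (X m (x ⊗ y)) ∘ fmap T (aassoc A (carrier m) (carrier x) (carrier y)).
Proof.
pose h := transport_inv (strict_carrier m x) ◀[A'] idm y.
apply: (@transport_algP _ _ _ _ _ (X m (x ⊗ y))
          (transport_hom (strict_carrier m (x ⊗ y)) ∘ aassoc A' m x y ∘ h)).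
have hE : (c m x ◀[A] idm (carrier y)) ∘ (c (m ◁[A'] x) y ∘ alg_map h)
    = c (X m x) y.
  rewrite strict_nat comp_assoc -bmap_comp /= eq_hom_esymr comp_idl.
  by rewrite bmap_id comp_idl.
by rewrite [alg_map _]/= -strict_assoc -!comp_assoc hE.
Qed.

Lemma strict_nabla_unit m :
  aunit A (carrier m) ∘ nabla (X m munit)
  = nabla m ∘ fmap T (aunit A (carrier m)).
Proof. by apply: (transport_algP (u := aunit A' m)); rewrite -strict_unit. Qed.

Definition lift_of_action : ActionLift :=
  {| lnabla := fun m x => nabla (X m x);
     lnabla_mu := fun m x => nabla_mu (X m x);
     lnabla_eta := fun m x => nabla_eta (X m x);
     lnabla_nat := strict_nabla_nat;
     lnabla_assoc := strict_nabla_assoc;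
     lnabla_unit := strict_nabla_unit |}.
End LiftOfAction.

(** The equalities between carriers must be generalized before the actions are
    taken apart: once the object parts are identified, the two families of
    retypings coincide by proof irrelevance, and being monic they leave no choice
    for the remaining components. *)
Lemma strict_action_eq A1 A2 (s1 : StrictOver A1) (s2 : StrictOver A2) :
  (forall m x, lnabla (lift_of_action s1) m x = lnabla (lift_of_action s2) m x) ->
  A1 = A2.
Proof.
move=> En.
have Eo m x : m ◁[A1] x = m ◁[A2] x.
  rewrite -(transport_algE (strict_carrier s1 m x)).
  rewrite -(transport_algE (strict_carrier s2 m x)).
  exact: Algebra_eq.
move: (strict_carrier s1) (strict_carrier s2)
  (@strict_nat _ s1) (@strict_nat _ s2)
  (strict_assoc s1) (strict_assoc s2) (strict_unit s1) (strict_unit s2).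
clear s1 s2 En.
case: A1 Eo => [[o1 b1 bi1 bc1] a1 u1 ai1 ui1 an1 un1 ap1 at1].
case: A2 => [[o2 b2 bi2 bc2] a2 u2 ai2 ui2 an2 un2 ap2 at2] /= Eo.
have {}Eo : o1 = o2.
  by apply: functional_extensionality_dep => m;
     apply: functional_extensionality_dep.
subst o2 => e1 e2.
have E : e1 = e2 by apply: proof_irrelevance.
subst e2 => nat1 nat2 assoc1 assoc2 unit1 unit2.
have E : b1 = b2.
  do 4 (apply: functional_extensionality_dep => ?).
  apply: functional_extensionality_dep => f.
  apply: functional_extensionality_dep => g.
  apply: AlgHom_eq.
  exact: eq_hom_mono (etrans (nat1 _ _ _ _ f g) (esym (nat2 _ _ _ _ f g))).
subst b2.
have E : a1 = a2.
  do 3 (apply: functional_extensionality_dep => ?).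
  apply: AlgHom_eq.
  exact: eq_hom_mono (etrans (esym (assoc1 _ _ _)) (assoc2 _ _ _)).
subst a2.
have E : u1 = u2.
  apply: functional_extensionality_dep => m.
  by apply: AlgHom_eq; rewrite -unit1 -unit2.
subst u2.
have E : bi1 = bi2 by apply: proof_irrelevance.
subst bi2.
have E : bc1 = bc2 by apply: proof_irrelevance.
subst bc2.
by f_equal; apply: proof_irrelevance.
Qed.

Definition strict_action_of_lift (L : ActionLift) : {A' | StrictOver A'} :=
  exist _ (action_of_lift L) (action_of_lift_strict L).

Definition lift_of_strict_action (S : {A' | StrictOver A'}) : ActionLift :=
  lift_of_action (proj2_sig S).

Lemma strict_action_of_liftK :
  cancel strict_action_of_lift lift_of_strict_action.
Proof.
move=> L; apply: ActionLift_eq => m x /=.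
by rewrite (proof_irrelevance _ (strict_carrier (action_of_lift_strict L) m x) erefl).
Qed.

Lemma lift_of_strict_actionK :
  cancel lift_of_strict_action strict_action_of_lift.
Proof.
move=> [A' sA'].
have E : action_of_lift (lift_of_action sA') = A'.
  apply: (strict_action_eq (s1 := action_of_lift_strict _) (s2 := sA')) => m x.
  (* Both actions have the same lift, by the other cancellation. *)
  pose n L := lnabla L m x.
  exact: (f_equal n (strict_action_of_liftK (lift_of_action sA'))).
refine (@eq_sig_hprop _ _ _ _ _ _) => [? ? ?|]; last exact: E.
exact: proof_irrelevance.
Qed.

End ActionLifts.

Theorem theorem5p31 (C : MonoidalCategory) (B : Bimonad C)
    (M : Category) (A : RightAction C M) (T : Monad M) :
  exists Phi : Coaction B A T ->
      {A' : RightAction (EM_monoidal B) (EM T)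
          | StrictComoduleFunctor A' A (EM_forget_oplax B) (EM_forget T)},
    bijective Phi
    /\ forall (Ta : Coaction B A T) (m : EM T) (x : EM_monoidal B),
        exists e : carrier (m ◁[sval (Phi Ta)] x) = carrier m ◁[A] carrier x,
          eq_hom e ∘ nabla (m ◁[sval (Phi Ta)] x)
          = (nabla m ◀[A] nabla x) ∘ Ta (carrier m) (carrier x)
            ∘ fmap T (eq_hom e).
Proof.
exists (fun Ta => strict_action_of_lift (lift_of_coaction Ta)); split.
- apply: (bij_comp (f := @strict_action_of_lift _ B _ A T)).
  + exact: Bijective (@strict_action_of_liftK _ _ _ _ _)
                     (@lift_of_strict_actionK _ _ _ _ _).
  + exact: Bijective (@lift_of_coactionK _ _ _ _ _)
                     (@coaction_of_liftK _ _ _ _ _).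
(* The action of a lift lies over [A] definitionally. *)
- by move=> Ta m x; exists erefl; rewrite /= fmap_id comp_idl comp_idr.
Qed.
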